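(* Let $\rho_A,\rho_B$ be convex risk measures on $\mathbb L_\infty(\mathbb P)$ continuous from above, and let $\mathcal V_T^A,\mathcal V_T^B\subset\mathbb L_\infty(\mathbb P)$ be (nonempty) convex sets such that there is a probability measure $\mathbb Q\sim\mathbb P$ with $\mathbb E_{\mathbb Q}[-\xi]\le0$ for all $\xi\in\mathcal V_T^A\cup\mathcal V_T^B$. Let $\rho_J^m(\Psi)=\inf_{\xi\in\mathcal V_T^J}\rho_J(\Psi-\xi)$ for $J=A,B$, with $\rho^m_J(0)>-\infty$, and assume $\rho_A^m\square\rho_B^m(0)>-\infty$. Let $X_T^A,X_T^B\in\mathbb L_\infty(\mathbb P)$ and set $R^m_{AB}=\rho_A^m\square\rho_B^m$, so that $$R^m_{AB}(X_T^A+X_T^B)=\inf_{F\in\mathbb L_\infty(\mathbb P)}\big\{\rho_A^m(X_T^A-F)+\rho_B^m(X_T^B+F)\big\}.$$ For $F^*\in\mathbb L_\infty(\mathbb P)$, the infimum is attained at $F^*$ if and only if there exists $\mathbf Q^X_{AB}\in\partial R^m_{AB}(X_T^A+X_T^B)$ such that $$\mathbf Q^X_{AB}\in\partial\rho_A^m(X_T^A-F^* )\cap\partial\rho_B^m(X_T^B+F^* ).$$ Equivalently, $F^*$ is an optimal solution if and only if there exists a finitely additive measure $\mathbf Q^X_{AB}$ optimal for $(X_T^A+X_T^B,R^m_{AB})$ such that $X_T^B+F^*$ is optimal for $(\mathbf Q^X_{AB},\alpha_B^m)$ and $X_T^A-F^*$ is optimal for $(\mathbf Q^X_{AB},\alpha_A^m)$,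 where $\alpha_A^m,\alpha_B^m$ are the minimal penalty functions of $\rho_A^m,\rho_B^m$.
   Context: $(\Omega,\mathcal F,\mathbb P)$ is a probability space. A convex risk measure on $\mathbb L_\infty(\mathbb P)$ is a map $\rho:\mathbb L_\infty(\mathbb P)\to\mathbb R$ that is convex, decreasing ($\Phi\le\Psi$ a.s. $\Rightarrow\rho(\Phi)\ge\rho(\Psi)$) and translation invariant ($\rho(\Phi+m)=\rho(\Phi)-m$, $m\in\mathbb R$). It is continuous from above if $\Psi_n\searrow\Psi$ a.s. implies $\rho(\Psi_n)\nearrow\rho(\Psi)$. $\mathbf M_{1,ac}(\mathbb P)$ is the set of finitely additive nonnegative set functions of total mass $1$ on $(\Omega,\mathcal F)$ vanishing on $\mathbb P$-null sets; $\mathbb E_{\mathbf Q}$ is the corresponding positive linear functional on $\mathbb L_\infty(\mathbb P)$. The minimal penalty function of $\rho$ is $\alpha(\mathbf Q)=\sup_{\Psi}\{\mathbb E_{\mathbf Q}[-\Psi]-\rho(\Psi)\}$. The subdifferential is $\partial\rho(\xi)=\{\mathbf Q\in\mathbf M_{1,ac}(\mathbb P):\ \rho(\xi+\Psi)\ge\rho(\xi)+\mathbb E_{\mathbf Q}[-\Psi]\ \forall\Psi\in\mathbb L_\infty(\mathbb P)\}$. ''$\mathbf Q$ is optimal for $(X,\rho)$'' means $\rho(X)=\mathbb E_{\mathbf Q}[-X]-\alpha(\mathbf Q)$, i.e. $\mathbf Q$ attains the dual representation $\rho(X)=\max_{\mathbf Q}\{\mathbb E_{\mathbf Q}[-X]-\alpha(\mathbf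 Q)\}$. ''$\Psi$ is optimal for $(\mathbf Q,\alpha)$'' means $\alpha(\mathbf Q)=\mathbb E_{\mathbf Q}[-\Psi]-\rho(\Psi)$, i.e. $\Psi$ attains the supremum defining $\alpha(\mathbf Q)$. The inf-convolution is $(\phi\square\psi)(X)=\inf_{H\in\mathbb L_\infty(\mathbb P)}\{\phi(X-H)+\psi(H)\}$. *)

(* Defs.v *)
From mathcomp Require Import all_boot all_order all_algebra.
From mathcomp Require Import all_classical all_reals all_analysis.

Set Implicit Arguments.
Unset Strict Implicit.
Unset Printing Implicit Defensive.

Import Order.TTheory GRing.Theory Num.Theory.
Import numFieldNormedType.Exports.

Local Open Scope classical_set_scope.
Local Open Scope ring_scope.

(* Elements are measurable, essentially bounded functions, not classes modulo
   P-a.s. equality.  Order and limits below are only tested P-a.s., so that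
   risk measures and the expectations [fexpectation Q], for Q in [M1ac P],
   take the same value on P-a.s. equal functions. *)
Notation Linfty P := (LfunType P (leey 1%E)).

Section risk_measures.
Context {d : measure_display} {T : measurableType d} {R : realType}.
Variable P : probability T R.

Lemma cst_Lfuny (m : R) : cst m \in Lfun P +oo%E.
Proof.
rewrite inE; apply/andP; split; rewrite inE//= /finite_norm unlock /Lnorm.
case: ifPn => // _; apply: (@le_lt_trans _ _ `|m|%:E); last exact: ltry.
by apply: ereal_inf_lbound; apply: nearW => x.
Qed.

Definition Linfty_cst (m : R) : Linfty P := Lfun_Sub (leey 1%E) (cst_Lfuny m).

Record convex_risk_measure (rho : Linfty P -> R) : Prop := ConvexRiskMeasure {
  crm_convex : convex_function setT rho ;
  crm_decreasing : forall Phi Psi : Linfty P,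
    {ae P, forall x, Phi x <= Psi x} -> rho Psi <= rho Phi ;
  crm_translation : forall (Phi : Linfty P) (m : R),
    rho (Phi + Linfty_cst m) = rho Phi - m }.

Definition continuous_from_above (rho : Linfty P -> R) : Prop :=
  forall (Psi_ : nat -> Linfty P) (Psi : Linfty P),
    {ae P, forall x, nonincreasing_seq (fun n => Psi_ n x) /\
                     Psi_ n x @[n --> \oo] --> Psi x} ->
    nondecreasing_seq (fun n => rho (Psi_ n)) /\
    rho (Psi_ n) @[n --> \oo] --> rho Psi.

Definition M1ac : set {content set T -> \bar R} :=
  [set Q | Q [set: T] = 1%E /\ content_dominates P Q].

(* The library integral only uses the set function through [sintegral], so it
   makes sense for a finitely additive Q.  For Q in [M1ac], the positive and
   negative parts of X in L_oo are Q-essentially limits of simple functions in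
   the sup-norm, hence this is the positive linear functional on L_oo mapping
   the indicator of A to Q A, although monotone convergence fails. *)
Definition fexpectation (Q : set T -> \bar R) (X : Linfty P) : \bar R :=
  (\int[Q]_x (X x)%:E)%E.

(* Functionals are extended-real valued because the infima defining
   [market_modified] and [inf_conv] may be -oo. *)
Implicit Types (phi psi : Linfty P -> \bar R) (Q : {content set T -> \bar R}).

Definition minimal_penalty phi Q : \bar R :=
  ereal_sup [set (fexpectation Q (- Psi)%R - phi Psi)%E | Psi in setT].

Definition subdifferential phi (xi : Linfty P)
    : set {content set T -> \bar R} :=
  [set Q | M1ac Q /\ forall Psi : Linfty P,
    (phi xi + fexpectation Q (- Psi)%R <= phi (xi + Psi)%R)%E].

Definition optimal_measure phi (X : Linfty P) Q : Prop :=
  M1ac Q /\ phi X = (fexpectation Q (- X)%R - minimal_penalty phi Q)%E.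

Definition optimal_position phi Q (Psi : Linfty P) : Prop :=
  minimal_penalty phi Q = (fexpectation Q (- Psi)%R - phi Psi)%E.

Definition inf_conv phi psi (X : Linfty P) : \bar R :=
  ereal_inf [set (phi (X - H)%R + psi H)%E | H in setT].

Definition market_modified (V : set (Linfty P)) (rho : Linfty P -> R)
    (Psi : Linfty P) : \bar R :=
  ereal_inf [set (rho (Psi - xi))%:E | xi in V].

End risk_measures.

(* Main.v *)
Require Import Defs.
From mathcomp Require Import all_boot all_order all_algebra.
From mathcomp Require Import all_classical all_reals all_analysis.
From HB Require Import structures.
From mathcomp Require Import measurable_realfun ess_sup_inf simple_functions.
From mathcomp Require Import ring lra.

(* The functions [rho^m_A], [rho^m_B] and their inf-convolution [R^m] are
   marginal infima of jointly convex functions, hence real-valued convex risk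
   measures.  A real-valued convex risk measure has a subgradient at every
   position: Hahn-Banach gives a linear functional, which monotonicity and
   translation invariance make positive and normalized, so that it is the
   expectation under some [Q] in [M1ac P].  If [Fstar] attains the infimum, then
   any subgradient [Q] of [R^m] at [XA + XB] is one of both [rho^m_A] and
   [rho^m_B], since [R^m (X + Y)] is at most [rho^m_A X + rho^m_B Y] with
   equality at [(XA - Fstar, XB + Fstar)].  Conversely, adding the subgradient
   inequalities of [rho^m_A] and [rho^m_B] for a common [Q] cancels the
   expectations.  Optimality for the penalty functions is the equality case of
   the Fenchel inequality, i.e. a reformulation of the subgradient property. *)

Set Implicit Arguments.
Unset Strict Implicit.
Unset Printing Implicit Defensive.

Import Order.TTheory GRing.Theory Num.Theory.
Import numFieldNormedType.Exports.

Local Open Scope classical_set_scope.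
Local Open Scope ring_scope.

(** * Subgradients of convex functions *)

Section hahn_banach.
Context {R : realType}.

(** A real-valued infimum presented by its two defining inequalities, so that properties of marginal
    infima follow by bounding one index at a time. *)
Lemma ex_infimum_family (X I : Type) (K : X -> set I) (F : X -> I -> R) :
  (forall x, K x !=set0) ->
  (forall x, exists m, forall k, K x k -> m <= F x k) ->
  exists g : X -> R, (forall x k, K x k -> g x <= F x k) /\
    (forall x m, (forall k, K x k -> m <= F x k) -> m <= g x).
Proof.
move=> K0 Kb; exists (fun x => inf (F x @` K x)); split=> [x k Kk|x m mF].
  have [m mF] := Kb x.
  by apply: ge_inf; [exists m => _ [j Kj <-]; exact: mF|exists k].
apply: lb_le_inf; first by have [k Kk] := K0 x; exists (F x k), k.
by move=> _ [k Kk <-]; exact: mF.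
Qed.

Variable V : lmodType R.

Definition sublinear (p : V -> R) :=
  (forall x y, p (x + y) <= p x + p y) /\
  (forall t x, 0 < t -> p (t *: x) <= t * p x).

Lemma sublinearZ p t x : sublinear p -> 0 < t -> p (t *: x) = t * p x.
Proof.
move=> [_ pZ] t0; apply/eqP; rewrite eq_le pZ//=.
have := pZ t^-1 (t *: x); rewrite invr_gt0 => /(_ t0).
by rewrite scalerA mulVf ?gt_eqF// scale1r ler_pdivlMl.
Qed.

Lemma sublinear0 p : sublinear p -> p 0 = 0.
Proof. by move=> sp; have := @sublinearZ p 2 0 sp; rewrite scaler0; lra. Qed.

Lemma sublinear_geN p x : sublinear p -> - p (- x) <= p x.
Proof.
by move=> sp; have := sp.1 x (- x); rewrite subrr sublinear0//; lra.
Qed.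

(** Subadditivity survives the infimum because, of two members of a chain, the smaller one serves
    for both arguments. *)
Lemma sublinear_chain_inf (A : set (V -> R)) (p : V -> R) :
  A !=set0 -> (forall q, A q -> sublinear q /\ forall x, q x <= p x) ->
  (forall q r, A q -> A r -> (forall x, q x <= r x) \/ (forall x, r x <= q x)) ->
  exists g, sublinear g /\ forall q, A q -> forall x, g x <= q x.
Proof.
move=> A0 Ap Atot.
have [||g [gA Ag]] := @ex_infimum_family V _ (fun=> A) (fun x q => q x).
- by [].
- move=> x; exists (- p (- x)) => q /Ap[sq qp].
  by apply: le_trans (sublinear_geN _ sq); rewrite lerN2.
exists g; split; last by move=> q Aq x; exact: gA.
split=> [x y|t x t0].
  rewrite -lerBlDr; apply: (Ag) => q Aq; rewrite lerBlDr -lerBlDl.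
  apply: (Ag) => r Ar; rewrite lerBlDl.
  have [qr|rq] := Atot _ _ Aq Ar.
    have [[qD _] _] := Ap _ Aq; have := qr y; have := qD x y.
    by have := gA (x + y) _ Aq; lra.
  have [[rD _] _] := Ap _ Ar; have := rq x; have := rD x y.
  by have := gA (x + y) _ Ar; lra.
rewrite -ler_pdivrMl//; apply: (Ag) => q Aq.
have [[_ qZ] _] := Ap _ Aq.
by rewrite ler_pdivrMl//; exact: le_trans (gA _ _ Aq) (qZ _ _ t0).
Qed.

(* The infimum of [q (x + t y) - t q y] over [t >= 0] is a sublinear minorant
   of [q], hence equals [q] by minimality; [t = 1] then gives additivity. *)
Lemma minimal_sublinear_additive q : sublinear q ->
  (forall r, sublinear r -> (forall x, r x <= q x) -> forall x, q x <= r x) ->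
  forall x y, q (x + y) = q x + q y.
Proof.
move=> sq qmin x y; apply/eqP; rewrite eq_le sq.1/=.
have [z|z|g [gle leg]] := @ex_infimum_family V _ (fun=> [set t | 0 <= t])
    (fun z t => q (z + t *: y) - t * q y).
- by exists 0 => /=.
(* Subadditivity bounds [q (t *: y)] by [q (z + t *: y) + q (- z)]; [t = 0] is apart since
   homogeneity is only given for [t > 0]. *)
- exists (- q (- z)) => t /= t0; have [->|tn0] := eqVneq t 0.
    by rewrite scale0r addr0 mul0r subr0; exact: sublinear_geN.
  rewrite -(sublinearZ _ sq) ?lt_neqAle 1?eq_sym ?tn0//.
  by have := sq.1 (z + t *: y) (- z); rewrite addrAC subrr add0r; lra.
have sg : sublinear g.
  split=> [z w|s z s0].
    rewrite -lerBlDr; apply: (leg) => t /= t0; rewrite lerBlDr -lerBlDl.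
    apply: (leg) => u /= u0; rewrite lerBlDl.
    have := gle (z + w) (t + u) (addr_ge0 t0 u0).
    have := sq.1 (z + t *: y) (w + u *: y).
    by rewrite addrACA -scalerDl; lra.
  rewrite -ler_pdivrMl//; apply: (leg) => t /= t0; rewrite ler_pdivrMl//.
  apply: le_trans (gle _ (s * t) (mulr_ge0 (ltW s0) t0)) _.
  by rewrite -scalerA -scalerDr (sublinearZ _ sq)// mulrBr mulrA.
have gq z : g z <= q z.
  by have := gle z 0 (lexx _); rewrite scale0r addr0 mul0r subr0.
have := qmin _ sg gq x; have := gle x 1 ler01; rewrite scale1r mul1r; lra.
Qed.

(** Zorn's lemma gives a minimal sublinear function below [p]; minimality makes it additive, and
    additivity extends homogeneity to all scalars. *)
Lemma sublinear_dominates_linear (p : V -> R) : sublinear p ->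
  exists l : {scalar V}, forall x, l x <= p x.
Proof.
move=> sp.
pose S := {q : V -> R | sublinear q /\ forall x, q x <= p x}.
(* The pointwise order is reversed, so that a maximal element is a minimal sublinear function. *)
pose ge_fun (q r : S) := `[< forall x, sval r x <= sval q x >].
have p0 : S by exists p.
have [|||q qmax] := @ZL_preorder S p0 ge_fun.
- by move=> q; apply/asboolP.
- move=> q r s /asboolP qr /asboolP rs; apply/asboolP => x.
  exact: le_trans (rs x) (qr x).
- move=> A Atot; have [A0|nA0] := pselect (A !=set0); last first.
    by exists p0 => s As; case: nA0; exists s.
  have [||| g [sg gA]] := @sublinear_chain_inf (sval @` A) p.
  + by case: A0 => a Aa; exists (sval a), a.
  + by move=> _ [a _ <-]; exact: (svalP a).
  + move=> _ _ [a Aa <-] [b Ab <-].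
    by have [/asboolP|/asboolP] := Atot _ _ Aa Ab; [right|left].
  have [a0 Aa0] := A0.
  have gp x : g x <= p x.
    by apply: le_trans (gA (sval a0) _ x) ((svalP a0).2 x); exists a0.
  exists (exist _ g (conj sg gp)) => a Aa; apply/asboolP => x /=.
  by apply: gA; exists a.
case: q qmax => q [sq qp] qmax.
have qD : forall x y, q (x + y) = q x + q y.
  apply: minimal_sublinear_additive => // r sr rq.
  have rp x : r x <= p x by exact: le_trans (rq x) (qp x).
  have := qmax (exist _ r (conj sr rp)).
  by move=> /(_ (asboolT rq))/asboolP.
have qN x : q (- x) = - q x.
  by have := qD x (- x); rewrite subrr sublinear0//; lra.
have qZ t x : q (t *: x) = t * q x.
  have [t0|t0|->] := ltgtP t 0; last by rewrite scale0r mul0r sublinear0.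
  - by rewrite -[t]opprK scaleNr qN sublinearZ ?oppr_gt0// !mulNr.
  - exact: sublinearZ.
have qlin : linear_for *%R q by move=> t x y; rewrite qD qZ.
by exists (HB.pack_for {scalar V} q (GRing.isLinear.Build R V R *%R q qlin)).
Qed.

(** The infimum over [t > 0] of the difference quotients is the directional derivative at [x0]; it
    is sublinear, and a linear function below it is a subgradient. *)
Lemma convex_subgradient (f : V -> R) (x0 : V) :
  (forall t x y, 0 <= t <= 1 ->
    f (t *: x + (1 - t) *: y) <= t * f x + (1 - t) * f y) ->
  exists l : {scalar V}, forall y, f x0 + l y <= f (x0 + y).
Proof.
move=> fconv.
have [y|y|g [gle leg]] := @ex_infimum_family V _ (fun=> [set t | 0 < t])
    (fun y t => (f (x0 + t *: y) - f x0) / t).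
- by exists 1 => /=.
(* [x0] lies between [x0 + t *: y] and [x0 - y], with weights [1 / (1 + t)] and [t / (1 + t)]. *)
- exists (f x0 - f (x0 - y)) => t /= t0; rewrite ler_pdivlMr//.
  have t10 : 0 < 1 + t by lra.
  have := fconv (1 + t)^-1 (x0 + t *: y) (x0 - y).
  have -> : (1 + t)^-1 *: (x0 + t *: y) + (1 - (1 + t)^-1) *: (x0 - y) = x0.
    rewrite !scalerDr addrACA -scalerDl subrKC scale1r scalerA scalerN -scalerBl.
    by rewrite (_ : _ - _ = 0) ?scale0r ?addr0//; field; rewrite gt_eqF.
  have -> : 0 <= (1 + t)^-1 <= 1.
    by rewrite invr_ge0 ltW//= invf_le1//; lra.
  move=> /(_ isT); rewrite -(ler_pM2l t10) mulrDr !mulrA mulrBr mulfV ?gt_eqF//.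
  by lra.
have [|l lg] := @sublinear_dominates_linear g.
  split=> [y z|s y s0].
    rewrite -lerBlDr; apply: (leg) => t /= t0; rewrite lerBlDr -lerBlDl.
    apply: (leg) => u /= u0; rewrite lerBlDl.
    have tu0 : 0 < t + u by lra.
    (* With this step size, [x0 + v *: (y + z)] is the convex combination of [x0 + t *: y] and
       [x0 + u *: z] with weights [u / (t + u)] and [t / (t + u)]. *)
    have v0 : 0 < t * u / (t + u) by rewrite divr_gt0// mulr_gt0.
    apply: le_trans (gle _ _ v0) _.
    rewrite ler_pdivrMr//.
    have := fconv (u / (t + u)) (x0 + t *: y) (x0 + u *: z).
    have -> : 1 - u / (t + u) = t / (t + u) by field; rewrite gt_eqF.
    rewrite divr_ge0 ?(ltW u0) ?(ltW tu0)//= ler_pdivrMr// mul1r.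
    rewrite lerDr (ltW t0) => /(_ isT).
    rewrite !scalerDr addrACA -scalerDl !scalerA.
    rewrite (_ : u / (t + u) + t / (t + u) = 1); last by field; rewrite gt_eqF.
    rewrite (_ : u / (t + u) * t = t * u / (t + u)); last by field; rewrite gt_eqF.
    rewrite (_ : t / (t + u) * u = t * u / (t + u)); last by field; rewrite gt_eqF.
    rewrite scale1r -scalerDr => h.
    rewrite lerBlDr (le_trans h)// le_eqVlt; apply/orP; left; apply/eqP.
    by field; rewrite !gt_eqF.
  rewrite -ler_pdivrMl//; apply: (leg) => t /= t0; rewrite ler_pdivrMl//.
  apply: le_trans (gle _ (t / s) (divr_gt0 t0 s0)) _.
  rewrite scalerA divfK ?gt_eqF// le_eqVlt; apply/orP; left; apply/eqP.
  by field; rewrite !gt_eqF.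
exists l => y; have := le_trans (lg y) (gle y 1 ltr01).
by rewrite scale1r divr1 lerBrDl.
Qed.

End hahn_banach.

(** * Positive functionals on [Linfty P] and finitely additive measures *)

Section Linfty_theory.
Context {d : measure_display} {T : measurableType d} {R : realType}.
Import HBNNSimple.
Variable P : probability T R.
Implicit Types X Y : Linfty P.

Lemma Linfty_ae_bounded X : exists2 M, 0 <= M & {ae P, forall x, `|X x| <= M}.
Proof.
have := Lfunction_finite _ X.
have P1 : (0 < P [set: T])%E by rewrite probability_setT lte01.
rewrite /finite_norm unlock /Lnorm; case: ifPn => [_ h|/negP/(_ P1)//].
pose M := ess_sup P (abse \o (EFin \o X)).
have [M' M'0 MM'] : exists2 M', 0 <= M' & (M <= M'%:E)%E.
  move: h; rewrite -/M; case: M => [r| |] // _; last by exists 0; rewrite ?leNye.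
  by exists (Num.max 0 r); rewrite ?le_max ?lexx// lee_fin le_max lexx orbT.
exists M' => //.
have : \forall x \ae P, ((abse \o (EFin \o X)) x <= M'%:E)%E by exact/ess_supP.
by apply: filterS => x /=; rewrite lee_fin.
Qed.

Lemma ae_bounded_Linfty (f : T -> R) (M : R) : measurable_fun setT f ->
  {ae P, forall x, `|f x| <= M} -> f \in Lfun P +oo%E.
Proof.
move=> mf fM; rewrite inE; apply/andP; split; rewrite inE//= /finite_norm.
rewrite unlock /Lnorm; case: ifPn => // _.
apply: (@le_lt_trans _ _ M%:E); last exact: ltry.
by apply/ess_supP; apply: filterS fM => x /=; rewrite lee_fin.
Qed.

(* Junk value: [toLinfty f] is [0] unless [f] is measurable and essentially
   bounded. *)
Definition toLinfty (f : T -> R) : Linfty P := insubd (0 : Linfty P) f.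

Lemma toLinftyE f : f \in Lfun P +oo%E -> toLinfty f = f :> (T -> R).
Proof. by move=> fP; rewrite /toLinfty; exact: (insubdK _ fP). Qed.

Lemma measurable_Linfty X : measurable_fun setT X.
Proof. exact: measurable_funPT. Qed.

Lemma indic_Lfun A : measurable A -> (\1_A : T -> R) \in Lfun P +oo%E.
Proof.
move=> mA; apply: (@ae_bounded_Linfty _ 1); first exact: measurable_indic.
apply: nearW => x; rewrite indicE.
by case: (_ \in _); rewrite ?normr1// normr0.
Qed.

Lemma nnsfun_Lfun (h : {nnsfun T >-> R}) : (h : T -> R) \in Lfun P +oo%E.
Proof.
have [M hM] : exists M, forall x, `|h x| <= M.
  have [M [_ hM]] := simple_bounded h.
  by exists (M + 1) => x; apply: hM => //; rewrite ltrDl.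
by apply: (@ae_bounded_Linfty _ M) => //; exact: nearW.
Qed.

Lemma funrpos_Lfun X : (X^\+)%R \in Lfun P +oo%E.
Proof.
have [M M0 XM] := Linfty_ae_bounded X.
apply: (@ae_bounded_Linfty _ M); first exact/measurable_funrpos/measurable_Linfty.
apply: filterS XM => x; rewrite /funrpos ler_norml => /andP[? ?].
by rewrite ger0_norm ?le_max ?lexx ?orbT// ge_max M0 andbT.
Qed.

Lemma nnsfun_lower_approx (f : T -> R) (M e : R) : measurable_fun setT f ->
  (forall x, 0 <= f x) -> 0 < e ->
  exists h : {nnsfun T >-> R},
    forall x, h x <= f x /\ (f x <= M -> f x <= h x + e).
Proof.
move=> mf f0 e0.
(* The [h] built at stage [n] is [e] times the number of levels [k * e], [1 <= k <= n], that [f]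
   reaches; each stage adds [e] on one more superlevel set. *)
suff stage n : exists h : {nnsfun T >-> R}, forall x,
    [/\ h x <= f x, h x <= n%:R * e & f x <= h x + e \/ h x = n%:R * e].
  (* More than [M / e] levels, so that where [f <= M] the cap [n%:R * e] is already above [f]. *)
  have [h hf] := stage (Num.truncn (M / e)).+1.
  exists h => x; have [hx1 _ hx2] := hf x; split=> // fM.
  case: hx2 => // hx2; rewrite hx2 (le_trans fM)//.
  have := ltW (truncnS_gt (M / e)); rewrite ler_pdivrMr// => /le_trans; apply.
  by rewrite lerDl ltW.
elim: n => [|n [h hf]].
  by exists nnsfun0 => x; rewrite mul0r lexx f0; split=> //; right.
have mA : measurable [set x | n.+1%:R * e <= f x].
  rewrite (_ : [set x | _] = f @^-1` `[n.+1%:R * e, +oo[); last first.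
    by apply/seteqP; split => x /=; rewrite in_itv/= andbT.
  by rewrite -[X in measurable X]setTI; exact: mf.
exists (add_nnsfun h (scale_nnsfun (indic_nnsfun R mA) (ltW e0))) => x.
have [h1 h2 h3] := hf x.
rewrite /= mindicE (_ : (x \in _) = (n.+1%:R * e <= f x)); last first.
  by apply/idP/idP; rewrite inE.
rewrite -natr1 mulrDl mul1r.
have [Ax|Ax] := leP (n%:R * e + e) (f x); rewrite ?mulr1 ?mulr0 ?addr0.
  by split; [lra|lra|right; case: h3 => h3; lra].
by split; [lra|lra|left; case: h3 => h3; lra].
Qed.

(** * Integrals against the set function of a positive linear functional *)

Section positive_functional.
Variables (l : {scalar Linfty P}) (Q : set T -> \bar R).
Hypothesis l_ge0 : forall X, {ae P, forall x, 0 <= X x} -> 0 <= l X.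
Hypothesis lQ : forall A, measurable A -> Q A = (l (toLinfty \1_A))%:E.

Lemma positive_functional_le X Y : {ae P, forall x, X x <= Y x} -> l X <= l Y.
Proof.
move=> XY; rewrite -subr_ge0 -linearB; apply: l_ge0.
by apply: filterS XY => x; rewrite -subr_ge0.
Qed.

Lemma sintegral_functional (h : {nnsfun T >-> R}) :
  sintegral Q h = (l (toLinfty h))%:E.
Proof.
have Q0 : Q set0 = 0%E.
  rewrite lQ// indic0 (_ : toLinfty (cst 0) = 0) ?linear0//.
  by apply/LfuneqP => x; rewrite toLinftyE// -indic0; exact: indic_Lfun.
rewrite /sintegral -(fsbig_widen (range h) setT)//=; last first.
  by move=> x [_ /= /preimage10->]; rewrite Q0 mule0.
rewrite fsbig_finite//=.
have lZ a Z : a * l Z = l (a *: Z) by rewrite linearZ.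
under eq_bigr do rewrite lQ// -EFinM lZ.
rewrite sumEFin -linear_sum; congr (l _)%:E.
apply/LfuneqP => x; rewrite toLinftyE; last exact: nnsfun_Lfun.
rewrite fimfunE fsbig_finite//=.
elim: (finmap.enum_fset _) => [|y s IHs]; first by rewrite !big_nil.
by rewrite !big_cons -IHs -[in RHS](toLinftyE (indic_Lfun _)).
Qed.

(** Positivity of [l] bounds the supremum by [l X]; uniform approximation from below by simple
    functions, in place of monotone convergence, gives the other inequality. *)
Lemma nnintegral_functional X : (forall x, 0 <= X x) ->
  ereal_sup [set sintegral Q h | h in
    [set h : {nnsfun T >-> R} | forall x, ((h x)%:E <= (X x)%:E)%E]] = (l X)%:E.
Proof.
move=> X0; apply/eqP; rewrite eq_le; apply/andP; split.
  apply: ge_ereal_sup => _ [h hX <-]; rewrite sintegral_functional lee_fin.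
  apply: positive_functional_le; apply: nearW => x.
  by rewrite toLinftyE ?nnsfun_Lfun// -lee_fin.
have [M M0 XM] := Linfty_ae_bounded X.
apply/lee_addgt0Pr => e e0.
have l10 : 0 <= l (Linfty_cst P 1) by apply: l_ge0; apply: nearW => x /=.
(* Adding [1] keeps [c] positive even if [l] vanishes on constants; an error of [e / c] then costs
   at most [e] under [l]. *)
pose c := l (Linfty_cst P 1) + 1.
have c0 : 0 < c by rewrite /c; lra.
have [h hX] := nnsfun_lower_approx M (measurable_Linfty X) X0 (divr_gt0 e0 c0).
apply: (@le_trans _ _ (sintegral Q h + e%:E)%E); last first.
  rewrite leeD2r//; apply: ereal_sup_ubound; exists h => // x.
  by rewrite lee_fin; exact: (hX x).1.
rewrite sintegral_functional -EFinD lee_fin.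
apply: (@le_trans _ _ (l (toLinfty h + (e / c) *: Linfty_cst P 1))).
  apply: positive_functional_le; apply: filterS XM => x XM.
  have -> : (toLinfty h + (e / c) *: Linfty_cst P 1) x = h x + e / c * 1.
    by rewrite /= toLinftyE// nnsfun_Lfun.
  by rewrite mulr1; apply: (hX x).2; rewrite (le_trans (ler_norm _)).
rewrite linearD linearZ lerD2l/= -mulrA ger_pMr// mulrC ler_pdivrMr//.
by rewrite mul1r /c lerDl.
Qed.

Lemma fexpectation_functional X : fexpectation Q X = (l X)%:E.
Proof.
rewrite /fexpectation /integral patch_setT -/(EFin \o X) funerpos funerneg.
have posE Y : [set h : {nnsfun T >-> R} |
    forall x, ((h x)%:E <= (EFin \o funrpos Y) x)%E] =
    [set h : {nnsfun T >-> R} |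
      forall x, ((h x)%:E <= (toLinfty (funrpos Y) x)%:E)%E].
  by rewrite toLinftyE//; exact: funrpos_Lfun.
have intE Y : ereal_sup [set sintegral Q h | h in [set h : {nnsfun T >-> R} |
    forall x, ((h x)%:E <= (EFin \o funrpos Y) x)%E]] = (l (toLinfty (funrpos Y)))%:E.
  rewrite posE nnintegral_functional// => x.
  by rewrite toLinftyE ?funrpos_Lfun.
have -> : funrneg X = funrpos (- X)%R :> (T -> R) by rewrite -funrposN.
rewrite !intE -EFinB -linearB; congr (l _)%:E.
apply/LfuneqP => x.
transitivity (toLinfty (funrpos X) x - toLinfty (funrpos (- X)%R) x) => //.
have -> : X x = (funrpos X - funrneg X) x by rewrite funrposBneg.
by rewrite !toLinftyE ?funrpos_Lfun// -[in RHS]funrposN.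
Qed.

End positive_functional.


Lemma toLinfty_indic A : measurable A -> toLinfty \1_A = \1_A :> (T -> R).
Proof. by move=> mA; rewrite toLinftyE//; exact: indic_Lfun. Qed.

(** A Riesz-type representation: the content is the value of [l] on indicators, and positivity
    forces it to vanish on [P]-null sets. *)
Lemma functional_content (l : {scalar Linfty P}) :
  (forall X, {ae P, forall x, 0 <= X x} -> 0 <= l X) ->
  l (Linfty_cst P 1) = 1 ->
  exists2 Q : {content set T -> \bar R},
    M1ac P Q & forall X, fexpectation Q X = (l X)%:E.
Proof.
move=> l_ge0 l1.
(* The default [0] off the measurable sets keeps [q] nonnegative on every set, as a content
   requires. *)
pose q A : \bar R := if A \in measurable then (l (toLinfty \1_A))%:E else 0%E.
have qE A : measurable A -> q A = (l (toLinfty \1_A))%:E.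
  by move=> mA; rewrite /q mem_set.
have q_ge0 A : (0 <= q A)%E.
  rewrite /q; case: ifPn => //; rewrite inE => mA; rewrite lee_fin.
  by apply: l_ge0; apply: nearW => x; rewrite toLinfty_indic.
have q_null A : measurable A -> P A = 0%E -> q A = 0%E.
  move=> mA PA0; rewrite qE// (_ : l _ = 0)//.
  have A_ae : {ae P, forall x, toLinfty \1_A x = 0}.
    exists A; split => // x /= /eqP; rewrite toLinfty_indic// indicE.
    by case: (boolP (x \in A)); rewrite ?inE// eqxx.
  apply/eqP; rewrite eq_le -oppr_ge0 -linearN !l_ge0//.
    by apply: filterS A_ae => x ->.
  apply: filterS A_ae => x xA.
  by rewrite (_ : (- toLinfty \1_A) x = - toLinfty \1_A x)// xA oppr0.
have q0 : q set0 = 0%E by apply: q_null => //; rewrite measure0.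
have q_add : measure_function.semi_additive q.
  apply/additive2P => // A B mA mB AB0.
  rewrite !qE//; last exact: measurableU.
  rewrite -EFinD -linearD; congr (l _)%:E; apply/LfuneqP => x.
  rewrite toLinfty_indic; last exact: measurableU.
  have -> : (toLinfty \1_A + toLinfty \1_B) x = \1_A x + \1_B x.
    by rewrite -[in RHS](toLinfty_indic mA) -[in RHS](toLinfty_indic mB).
  rewrite !indicE in_setU; case: (boolP (x \in A)) => xA; rewrite ?addr0 ?add0r//=.
  case: (boolP (x \in B)) => xB; rewrite ?addr0//.
  by move: xA xB; rewrite !inE => xA xB; have : (A `&` B) x by []; rewrite AB0.
pose Q := HB.pack_for {content set T -> \bar R} q (isContent.Build d T R q q_ge0 q_add).
exists Q; last first.
  by move=> X; apply: (fexpectation_functional l_ge0).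
split=> //.
rewrite /= qE// (_ : toLinfty _ = Linfty_cst P 1) ?l1//.
by apply/LfuneqP => x; rewrite toLinfty_indic// indicT.
Qed.

(** * Linearity of the integral against a finitely additive measure *)

Section content_functional.
Variable Q : {content set T -> \bar R}.
Hypothesis MQ : M1ac P Q.

(** The sets in the list may overlap, so that addition of step functions is concatenation and
    scaling is a map. *)
Let step (s : seq (R * {A : set T | measurable A})) (x : T) : R :=
  \sum_(p <- s) p.1 * \1_(sval p.2) x.

Let mass A : R := fine (Q A).

Let integ (s : seq (R * {A : set T | measurable A})) : R :=
  \sum_(p <- s) p.1 * mass (sval p.2).

Let content_fin A : measurable A -> Q A \is a fin_num.
Proof.
move=> mA; rewrite ge0_fin_numE// (@le_lt_trans _ _ (Q setT))//.
  by apply: le_measure => //; rewrite inE.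
by rewrite MQ.1 ltry.
Qed.

Let mass_split A B : measurable A -> measurable B ->
  mass A = mass (A `&` B) + mass (A `\` B).
Proof.
move=> mA mB; have mI := measurableI _ _ mA mB; have mD := measurableD mA mB.
rewrite /mass -fineD ?content_fin// -measureU//.
  by rewrite setUIDK.
by rewrite setDE setIACA setICr setI0.
Qed.

(* The set [B] makes the induction on [s] go through: splitting [B] along the
   first set of [s] turns its coefficient into a shift of the constant [c]. *)
Let step_ge0 s (c : R) B : measurable B ->
  {ae P, forall x, B x -> 0 <= c + step s x} ->
  0 <= c * mass B + \sum_(p <- s) p.1 * mass (sval p.2 `&` B).
Proof.
elim: s c B => [|[a [A mA]] s IHs] c B mB; rewrite /step.
  rewrite !big_nil addr0 => Bc.
  have [c0|c0] := leP 0 c; first by rewrite mulr_ge0// fine_ge0.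
  (* If [c < 0], the hypothesis makes [B] a [P]-null set, on which [Q] vanishes. *)
  suff -> : mass B = 0 by rewrite mulr0.
  rewrite /mass MQ.2//; apply: measure_negligible => //.
  apply: negligibleS Bc => x Bx /=; rewrite big_nil addr0 => /(_ Bx).
  by rewrite leNgt c0.
move=> h.
have h1 : {ae P, forall x, (B `&` A) x -> 0 <= c + a + step s x}.
  apply: filterS h => x /= h [Bx Ax].
  by have := h Bx; rewrite big_cons/= indicE mem_set// mulr1 addrA.
have h2 : {ae P, forall x, (B `\` A) x -> 0 <= c + step s x}.
  apply: filterS h => x /= h [Bx Ax].
  by have := h Bx; rewrite big_cons/= indicE memNset// mulr0 add0r.
have {}h1 := IHs _ _ (measurableI _ _ mB mA) h1.
have {}h2 := IHs _ _ (measurableD mB mA) h2.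
rewrite big_cons/= (mass_split mB mA).
have -> : \sum_(p <- s) p.1 * mass (sval p.2 `&` B) =
    \sum_(p <- s) p.1 * mass (sval p.2 `&` (B `&` A)) +
    \sum_(p <- s) p.1 * mass (sval p.2 `&` (B `\` A)).
  rewrite -big_split/=; apply: eq_bigr => -[b [C mC]] _ /=.
  by rewrite -mulrDr (mass_split (measurableI _ _ mC mB) mA) setIA setIDA.
by rewrite (setIC A B); lra.
Qed.

(* Linearity of the library integral for a finitely additive [Q]: Hahn-Banach
   applied to the least [Q]-mass of a step function dominating [X] a.s. gives a
   linear functional with value [Q A] at [\1_A], and [fexpectation_functional]
   identifies it with the integral. *)
Lemma content_functional : exists l : {scalar Linfty P},
  forall X, fexpectation Q X = (l X)%:E.
Proof.
have mT := @measurableT d T.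
have massT : mass setT = 1 by rewrite /mass MQ.1.
pose K X := [set s | {ae P, forall x, X x <= step s x}].
have [X|X|g [gle leg]] := @ex_infimum_family R _ _ K (fun=> integ).
- have [M M0 XM] := Linfty_ae_bounded X.
  exists [:: (M, exist _ _ mT)]; apply: filterS XM => x XM.
  rewrite /step big_seq1/= indicT/= mulr1.
  exact: le_trans (ler_norm _) XM.
(* A step function above [X] is at least [- M] a.s., so [step_ge0] with constant [M] on the whole
   space bounds its mass below. *)
- have [M M0 XM] := Linfty_ae_bounded X.
  exists (- M) => s Xs; have := @step_ge0 s M setT mT.
  rewrite massT mulr1 /integ; under eq_bigr do rewrite setIT.
  rewrite -lerBlDl sub0r; apply.
  apply: filterS2 XM Xs => x; rewrite ler_norml => /andP[? _] ? _; lra.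
have [|l lg] := @sublinear_dominates_linear R (Linfty P) g.
  split=> [X Y|t X t0].
    rewrite -lerBlDr; apply: (leg) => s Xs; rewrite lerBlDr -lerBlDl.
    apply: (leg) => r Yr; rewrite lerBlDl.
    have -> : integ s + integ r = integ (s ++ r) by rewrite /integ big_cat.
    apply: gle; apply: filterS2 Xs Yr => x Xs Yr.
    by rewrite /step big_cat/=; exact: lerD.
  rewrite -ler_pdivrMl//; apply: (leg) => s Xs; rewrite ler_pdivrMl//.
  have -> : t * integ s = integ [seq (t * p.1, p.2) | p <- s].
    by rewrite /integ big_map mulr_sumr; apply: eq_bigr => p _ /=; rewrite mulrA.
  apply: gle; apply: filterS Xs => x Xs.
  rewrite /step big_map; under eq_bigr do rewrite /= -mulrA.
  by rewrite -mulr_sumr; apply: ler_wpM2l => //; exact: ltW.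
exists l; apply: fexpectation_functional => [X X0|A mA].
  (* If [X] is nonnegative a.s., the empty list dominates [- X] at mass [0]. *)
  rewrite -oppr_le0 -linearN (le_trans (lg _))//.
  have -> : 0 = integ [::] :> R by rewrite /integ big_nil.
  apply: gle; apply: filterS X0 => x X0.
  by rewrite /step big_nil oppr_le0.
(* The signs [a = 1] and [a = - 1] give the two inequalities between [l] at the indicator and the
   mass of [A]. *)
have massl a : a * l (toLinfty \1_A) <= a * mass A.
  have -> : a * l (toLinfty \1_A) = l (a *: toLinfty \1_A) by rewrite linearZ.
  have -> : a * mass A = integ [:: (a, exist _ _ mA)].
    by rewrite /integ big_seq1.
  rewrite (le_trans (lg _))//; apply: gle; apply: nearW => x.
  by rewrite /step big_seq1/= -[in leRHS](toLinfty_indic mA).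
rewrite -(fineK (content_fin mA)); congr EFin; apply/eqP.
rewrite eq_le -/(mass A); have := massl 1; have := massl (- 1).
by rewrite !mulN1r lerN2 !mul1r => -> ->.
Qed.

End content_functional.

End Linfty_theory.

(** * Convex risk measures and their subdifferentials *)

Section risk_measure_duality.
Context {d : measure_display} {T : measurableType d} {R : realType}.
Variable P : probability T R.
Implicit Types (X Y H : Linfty P) (r f g : Linfty P -> R).
Implicit Types (V : set (Linfty P)) (Q : {content set T -> \bar R}).

Lemma convex_functionP (E : lmodType R) (f : E -> R) : convex_function setT f <->
  forall t x y, 0 <= t <= 1 ->
    f (t *: x + (1 - t) *: y) <= t * f x + (1 - t) * f y.
Proof.
split=> [fconv t x y /andP[t0 t1]|fconv t x y _ _].
  by have := fconv (Itv01 t0 t1) x y; rewrite !inE; exact.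
by apply: fconv; rewrite ge0 le1.
Qed.

Lemma convex_setP (E : lmodType R) (V : set E) t x y :
  convex_set V -> 0 <= t <= 1 -> V x -> V y -> V (t *: x + (1 - t) *: y).
Proof.
move=> Vconv /andP[t0 t1] Vx Vy.
by have := Vconv x y (Itv01 t0 t1); rewrite !inE; exact.
Qed.

(** Joint convexity passes to the infimum over a convex set of parameters. Finiteness at [0] spreads
    to every position, since positions are bounded a.s. and [F] is monotone and translation
    invariant. *)
Lemma crm_marginal (I : lmodType R) (K : set I) (F : Linfty P -> I -> R) :
  K !=set0 -> convex_set K ->
  (forall t X Y i j, 0 <= t <= 1 ->
     F (t *: X + (1 - t) *: Y) (t *: i + (1 - t) *: j) <=
     t * F X i + (1 - t) * F Y j) ->
  (forall i X Y, {ae P, forall x, X x <= Y x} -> F Y i <= F X i) ->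
  (forall i X m, F (X + Linfty_cst P m) i = F X i - m) ->
  (-oo < ereal_inf [set (F 0 i)%:E | i in K])%E ->
  exists2 g, convex_risk_measure g &
    forall X, ereal_inf [set (F X i)%:E | i in K] = (g X)%:E.
Proof.
move=> [i0 Ki0] Kconv Fconv Fdec Ftrans F0.
have [b bF] : exists b, forall i, K i -> b <= F 0 i.
  have ub : (ereal_inf [set (F 0 i)%:E | i in K] <= (F 0 i0)%:E)%E.
    by apply: ereal_inf_lbound; exists i0.
  have fin : ereal_inf [set (F 0 i)%:E | i in K] \is a fin_num.
    by rewrite fin_numE gt_eqF//= lt_eqF// (le_lt_trans ub)// ltry.
  exists (fine (ereal_inf [set (F 0 i)%:E | i in K])) => i Ki.
  by rewrite -lee_fin fineK//; apply: ereal_inf_lbound; exists i.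
have [X|X|g [gle leg]] := @ex_infimum_family R _ _ (fun=> K) F.
- by exists i0.
- have [M M0 XM] := Linfty_ae_bounded X.
  exists (b - M) => i Ki; apply: le_trans (Fdec i X (0 + Linfty_cst P M) _).
    by rewrite Ftrans lerB// bF.
  apply: filterS XM => x; rewrite ler_norml => /andP[_].
  by rewrite add0r.
exists g; last first.
  move=> X; apply/eqP; rewrite eq_le; apply/andP; split; last first.
    by apply: le_ereal_inf_tmp => _ [i Ki <-]; rewrite lee_fin gle.
  have : (ereal_inf [set (F X i)%:E | i in K] <= (F X i0)%:E)%E.
    by apply: ereal_inf_lbound; exists i0.
  case E : ereal_inf => [a| |] //= _; rewrite ?leNye// lee_fin; apply: (leg) => i Ki.
  by rewrite -lee_fin -E; apply: ereal_inf_lbound; exists i.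
split.
- apply/convex_functionP => t X Y t01.
  have /andP[t0 t1] := t01.
  have key i j : K i -> K j ->
      g (t *: X + (1 - t) *: Y) <= t * F X i + (1 - t) * F Y j.
    move=> Ki Kj; apply: le_trans (gle _ _ (convex_setP Kconv t01 Ki Kj)) _.
    exact: Fconv.
  (* The endpoints are apart because taking the two infima in turn divides by [t] and [1 - t]. *)
  have [t00|tn0] := eqVneq t 0.
    move: key; rewrite t00 !mul0r !subr0 !add0r !mul1r => key.
    by apply: (leg) => j Kj; have := key i0 j Ki0 Kj; rewrite mul0r add0r mul1r.
  have [t11|tn1] := eqVneq t 1.
    move: key; rewrite t11 subrr !mul0r !addr0 !mul1r => key.
    by apply: (leg) => i Ki; have := key i i0 Ki Ki0; rewrite mul0r addr0 mul1r.
  have tp : 0 < t by rewrite lt_neqAle eq_sym tn0.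
  have tp' : 0 < 1 - t by rewrite subr_gt0 lt_neqAle tn1.
  rewrite -lerBlDr -ler_pdivrMl//; apply: (leg) => i Ki.
  rewrite ler_pdivrMl// lerBlDr -lerBlDl -ler_pdivrMl//; apply: (leg) => j Kj.
  by rewrite ler_pdivrMl// lerBlDl key.
- move=> X Y XY; apply: (leg) => i Ki; exact: le_trans (gle _ _ Ki) (Fdec _ _ _ XY).
- move=> X m; apply/eqP; rewrite eq_le; apply/andP; split.
    rewrite lerBrDr; apply: (leg) => i Ki.
    by rewrite -lerBrDr -Ftrans gle.
  by apply: (leg) => i Ki; rewrite Ftrans lerB// gle.
Qed.

Lemma crm_market_modified V r : convex_risk_measure r ->
  V !=set0 -> convex_set V -> (-oo < market_modified V r 0%R)%E ->
  exists2 g, convex_risk_measure g & market_modified V r = EFin \o g.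
Proof.
move=> [/convex_functionP rconv rdec rtrans] V0 Vconv V0oo.
have [|i X Y XY|i X m||g crmg gE] :=
    @crm_marginal _ V (fun X xi => r (X - xi)) V0 Vconv.
- move=> t X Y i j t01; apply: le_trans (rconv _ _ _ t01).
  by rewrite opprD addrACA -!scalerN -!scalerDr.
- apply: rdec; apply: filterS XY => x XY.
  by rewrite -[leLHS]/(X x - i x) -[leRHS]/(Y x - i x) lerB.
- by rewrite addrAC rtrans.
- exact: V0oo.
by exists g => //; apply/funext => X; exact: gE.
Qed.

Lemma crm_inf_conv f g : convex_risk_measure f -> convex_risk_measure g ->
  (-oo < inf_conv (EFin \o f) (EFin \o g) 0%R)%E ->
  exists2 h, convex_risk_measure h &
    inf_conv (EFin \o f) (EFin \o g) = EFin \o h.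
Proof.
move=> [/convex_functionP fconv fdec ftrans] [/convex_functionP gconv _ _] fg0.
have T0 : [set: Linfty P] !=set0 by exists 0.
have Tconv : convex_set [set: Linfty P] by move=> x y t _ _; rewrite inE.
have [|i X Y XY|i X m||h crmh hE] :=
    @crm_marginal _ _ (fun X H => f (X - H) + g H) T0 Tconv.
- move=> t X Y i j t01; rewrite opprD addrACA -!scalerN -!scalerDr.
  by have := fconv t (X - i) (Y - j) t01; have := gconv t i j t01; lra.
- rewrite lerD2r; apply: fdec; apply: filterS XY => x XY.
  by rewrite -[leLHS]/(X x - i x) -[leRHS]/(Y x - i x) lerB.
- by rewrite addrAC ftrans addrAC.
- exact: fg0.
by exists h => //; apply/funext => X; exact: hE.
Qed.

Lemma subdifferential_neq0 r X : convex_risk_measure r ->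
  subdifferential (EFin \o r) X !=set0.
Proof.
move=> [/convex_functionP rconv rdec rtrans].
(* Reflecting the argument turns the decreasing [r] into an increasing function, so that its
   subgradient is a positive functional. *)
have [t A B t01|l lX] := @convex_subgradient R _ (fun Y => r (- Y)) (- X).
  by rewrite opprD -!scalerN; exact: rconv.
have {}lX Y : r X + l Y <= r (X - Y) by have := lX Y; rewrite opprD !opprK.
have l_ge0 Y : {ae P, forall x, 0 <= Y x} -> 0 <= l Y.
  move=> Y0; have := lX (- Y); rewrite opprK linearN.
  have : r (X + Y) <= r X.
    by apply: rdec; apply: filterS Y0 => x Y0; rewrite -[leRHS]/(X x + Y x) lerDl.
  by lra.
have l1 : l (Linfty_cst P 1) = 1.
  (* Translation invariance makes the subgradient inequality exact on constants; [m = 1] and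
     [m = - 1] bound [l] at the constant [1] on both sides. *)
  have lm m : l (Linfty_cst P m) <= m.
    have := lX (Linfty_cst P m).
    have -> : - Linfty_cst P m = Linfty_cst P (- m) by apply/LfuneqP.
    by rewrite rtrans; lra.
  apply/eqP; rewrite eq_le lm/=; have := lm (- 1).
  have -> : Linfty_cst P (- 1) = - Linfty_cst P 1 by apply/LfuneqP.
  by rewrite linearN; lra.
have [Q MQ QE] := functional_content l_ge0 l1.
by exists Q; split=> // Y; rewrite QE -EFinD lee_fin -[Y in X + Y]opprK lX.
Qed.

(** By linearity of the expectation, the subgradient inequality in the direction [Y - X] says that
    [X] does at least as well as [Y] in the supremum defining the penalty. *)
Lemma subdifferentialE r X Q : M1ac P Q ->
  subdifferential (EFin \o r) X Q <-> optimal_position (EFin \o r) Q X.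
Proof.
move=> MQ; have [l QE] := content_functional MQ.
rewrite /subdifferential /optimal_position /minimal_penalty; split=> [[_ XQ]|h].
  apply/eqP; rewrite eq_le; apply/andP; split; last first.
    by apply: ereal_sup_ubound; exists X.
  apply: ge_ereal_sup => _ [Y _ <-].
  have := XQ (Y - X); rewrite subrKC !QE/=.
  by rewrite -!EFinB -EFinD !lee_fin !linearN/= linearD/= linearN/=; lra.
split=> // Y; have : (fexpectation Q (- (X + Y))%R - (r (X + Y))%:E <=
    fexpectation Q (- X)%R - (r X)%:E)%E.
  by rewrite -h; apply: ereal_sup_ubound; exists (X + Y).
by rewrite !QE/= -!EFinB -EFinD !lee_fin !linearN/= linearD/=; lra.
Qed.

Lemma optimal_measureE r X Q :
  optimal_measure (EFin \o r) X Q <-> subdifferential (EFin \o r) X Q.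
Proof.
suff PE : M1ac P Q -> optimal_position (EFin \o r) Q X <->
    (r X)%:E = (fexpectation Q (- X)%R - minimal_penalty (EFin \o r) Q)%E.
  split=> [[MQ h]|XQ]; first by apply/subdifferentialE => //; apply/PE.
  by split; [exact: XQ.1|apply/(PE XQ.1)/subdifferentialE; [exact: XQ.1|]].
move=> MQ; have [l QE] := content_functional MQ.
rewrite /optimal_position QE /=.
(* For an infinite penalty both equalities fail, the other terms being real. *)
case: (minimal_penalty _ _) => [a| |]; split => //.
  by move=> [->]; congr EFin; lra.
by move=> [->]; congr EFin; lra.
Qed.

Lemma inf_conv_attainedP f g h (X Y : Linfty P) :
  inf_conv (EFin \o f) (EFin \o g) = EFin \o h -> convex_risk_measure h ->
  f X + g Y = h (X + Y) <->
  exists2 Q, subdifferential (EFin \o h) (X + Y) Q &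
    (subdifferential (EFin \o f) X `&` subdifferential (EFin \o g) Y) Q.
Proof.
move=> hE crmh.
have hle A B : h (A + B) <= f A + g B.
  rewrite -lee_fin -[leLHS]/((EFin \o h) _) -hE EFinD; apply: ereal_inf_lbound.
  by exists B => //=; rewrite addrK.
split=> [XY|[Q [MQ _] [[_ QX] [_ QY]]]].
  have [Q [MQ hQ]] := subdifferential_neq0 (X + Y) crmh.
  (* Perturbing one summand by [H] and keeping the other leaves [h] below the perturbed sum, with
     equality at [H = 0]. *)
  exists Q => //; have [l QE] := content_functional MQ.
  split; split=> // H; have := hQ H; rewrite QE/= -!EFinD !lee_fin -XY.
    by have := hle (X + H) Y; rewrite addrAC; lra.
  by have := hle X (Y + H); rewrite addrA; lra.
apply/eqP; rewrite eq_le hle andbT -lee_fin.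
rewrite -[leRHS]/((EFin \o h) _) -hE; apply: le_ereal_inf_tmp => _ [H _ <-].
have [l QE] := content_functional MQ.
(* These directions lead from [(X, Y)] to the competitor [(X + Y - H, H)]; being opposite, they have
   cancelling expectations. *)
have := QX (Y - H); have := QY (H - Y).
rewrite !QE/= -!EFinD !lee_fin subrKC (addrA X) !linearN/= !linearB/=; lra.
Qed.

End risk_measure_duality.

(** * Characterization of optimal risk transfers *)

Theorem theorem4p7 (d : measure_display) (T : measurableType d) (R : realType)
    (P : probability T R) (rhoA rhoB : Linfty P -> R)
    (VA VB : set (Linfty P))
    (crmA : convex_risk_measure rhoA) (crmB : convex_risk_measure rhoB)
    (cfaA : continuous_from_above rhoA) (cfaB : continuous_from_above rhoB)
    (VA0 : VA !=set0) (VB0 : VB !=set0)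
    (cvxA : convex_set VA) (cvxB : convex_set VB)
    (QQ : exists Q0 : probability T R, [/\ Q0 `<< P, P `<< Q0 &
      forall xi : Linfty P, (VA `|` VB) xi -> ('E_Q0[(- xi)%R] <= 0)%E])
    (rhoAm0 : (-oo < market_modified VA rhoA 0%R)%E)
    (rhoBm0 : (-oo < market_modified VB rhoB 0%R)%E)
    (Rm0 : (-oo < inf_conv (market_modified VA rhoA)
                           (market_modified VB rhoB) 0%R)%E)
    (XA XB Fstar : Linfty P) :
  let rhoAm := market_modified VA rhoA in
  let rhoBm := market_modified VB rhoB in
  let Rm := inf_conv rhoAm rhoBm in
  let objective (F : Linfty P) := (rhoAm (XA - F)%R + rhoBm (XB + F)%R)%E in
  let attained := objective Fstar = ereal_inf [set objective F | F in setT] in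
  [/\ Rm (XA + XB)%R = ereal_inf [set objective F | F in setT],
      attained <->
        exists2 Q : {content set T -> \bar R},
          subdifferential Rm (XA + XB)%R Q &
          (subdifferential rhoAm (XA - Fstar)%R `&`
           subdifferential rhoBm (XB + Fstar)%R) Q
    & attained <->
        exists Q : {content set T -> \bar R},
          [/\ optimal_measure Rm (XA + XB)%R Q,
              optimal_position rhoBm Q (XB + Fstar)%R
            & optimal_position rhoAm Q (XA - Fstar)%R]].
Proof.
move=> rhoAm rhoBm Rm objective attained.
have [gA crmgA gAE] := crm_market_modified crmA VA0 cvxA rhoAm0.
have [gB crmgB gBE] := crm_market_modified crmB VB0 cvxB rhoBm0.
have [h crmh hE] : exists2 h, convex_risk_measure h & Rm = EFin \o h.
  by rewrite /Rm /rhoAm /rhoBm gAE gBE; apply: crm_inf_conv => //; rewrite -gAE -gBE.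
have RmE : Rm (XA + XB) = ereal_inf [set objective F | F in setT].
  congr ereal_inf; apply/seteqP; split=> [_ [H _ <-]|_ [F _ <-]].
    (* The claim transferred and the inf-convolution variable are related by [H = XB + F]. *)
    exists (H - XB) => //; rewrite /objective subrKC; congr (rhoAm _ + _)%E.
    by rewrite opprB addrA addrAC.
  exists (XB + F) => //; rewrite /objective; congr (rhoAm _ + _)%E.
  by rewrite opprD addrA addrK.
have attainedE : attained <-> gA (XA - Fstar) + gB (XB + Fstar) = h (XA + XB).
  rewrite /attained -RmE hE /objective /rhoAm /rhoBm gAE gBE /= -EFinD.
  by split=> [[]|->].
have XE : XA + XB = (XA - Fstar) + (XB + Fstar).
  by rewrite addrACA addNr addr0.
have hAB : inf_conv (EFin \o gA) (EFin \o gB) = EFin \o h.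
  by rewrite -gAE -gBE.
have subdiffP := inf_conv_attainedP (XA - Fstar) (XB + Fstar) hAB crmh.
rewrite -XE in subdiffP.
split; first exact: RmE.
  by rewrite attainedE /rhoAm /rhoBm gAE gBE hE.
rewrite attainedE subdiffP /rhoAm /rhoBm gAE gBE hE.
split=> [[Q hQ [QA QB]]|[Q [/optimal_measureE hQ QB QA]]].
  have MQ := hQ.1; exists Q; split; first exact/optimal_measureE.
    exact/subdifferentialE.
  exact/subdifferentialE.
by exists Q => //; split; apply/subdifferentialE => //; exact: hQ.1.
Qed.
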